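(* Let $r\ge 3$ be an integer. There exist constants $\varepsilon_0(r)>0$ and $C(r)>0$, depending only on $r$, such that the following holds for all $0<p\le\frac{r-1}{r}$, all $0<\varepsilon\le\varepsilon_0(r)$ and all $n\ge 1$. Let $\mathcal F_1,\dots,\mathcal F_r\subseteq 2^{[n]}$ be $r$-cross-intersecting. If $$\prod_{i=1}^r\mu_p(\mathcal F_i)\ge (1-\varepsilon)p^r,$$ then there exists $j\in[n]$ such that for all $i\in[r]$, $$\mu_p(\mathcal F_i\,\Delta\,\mathcal S_j)\le C(r)\,p\,\varepsilon.$$
   Context: $[n]=\{1,\dots,n\}$ and $2^{[n]}$ is its power set. For $0\le p\le 1$ and $\mathcal F\subseteq 2^{[n]}$, the $p$-biased measure is $\mu_p(\mathcal F)=\sum_{F\in\mathcal F}p^{|F|}(1-p)^{n-|F|}$. Families $\mathcal F_1,\dots,\mathcal F_r\subseteq 2^{[n]}$ are $r$-cross-intersecting if $A_1\cap\cdots\cap A_r\neq\varnothing$ for every choice of $A_i\in\mathcal F_i$, $i\in[r]$ (vacuously true if some $\mathcal F_i$ is empty). For $j\in[n]$, the $1$-star is $\mathcal S_j=\{A\subseteq[n]: j\in A\}$. $\mathcal F\Delta\mathcal G=(\mathcal F\setminus\mathcal G)\cup(\mathcal G\setminus\mathcal F)$ is the symmetric difference. *)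

(* Defs.v *)
From mathcomp Require Import all_boot all_order all_algebra.
From mathcomp Require Import reals.

Set Implicit Arguments.
Unset Strict Implicit.
Unset Printing Implicit Defensive.

Import Order.TTheory GRing.Theory Num.Theory.
Local Open Scope ring_scope.

(* The ground set [n] = {1, ..., n} is represented by 'I_n = {0, ..., n-1}. *)

Definition biased_measure (R : realType) (n : nat) (p : R)
    (F : {set {set 'I_n}}) : R :=
  \sum_(A in F) p ^+ #|A| * (1 - p) ^+ (n - #|A|).

Definition cross_intersecting (n r : nat) (F : 'I_r -> {set {set 'I_n}}) : Prop :=
  forall A : 'I_r -> {set 'I_n},
    (forall i, A i \in F i) -> \bigcap_(i < r) A i != set0.

Definition star (n : nat) (j : 'I_n) : {set {set 'I_n}} :=
  [set A : {set 'I_n} | j \in A].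

Definition symdiff (T : finType) (F G : {set T}) : {set T} :=
  (F :\: G) :|: (G :\: F).

(* Main.v *)
(**
Colour every point of the ground set independently and uniformly with one of
r colours and let A_i be the set of points not coloured i.  Then the A_i have
empty common intersection and each A_i has law mu_p0 with p0 = (r-1)/r, so
cross-intersecting families satisfy sum_i mu_p0(F_i) <= r - 1.  Call the
difference the deficit; it is the average of the deficits of the r
restrictions obtained by revealing the colour of one point.

Two of the A_i have correlation -1/(r-1), which is bounded away from -1 since
r >= 3.  This maximal correlation bound upgrades approximate information: if
one family is nearly empty and the others are nearly full, then they are so up
to 3 * deficit, and in a near-extremal situation no measure can stay away from
0 and 1.  Induction on the number of points then shows that increasing families
with small deficit are close either to such a trivial tuple or to a star, the
induction step restoring the closeness lost by revealing one point.

For p = p0^s with s >= 1 and increasing F one has mu_p(F) <= mu_p0(F)^s.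
Hence a nearly extremal product at p is nearly extremal at p0, where AM-GM
turns it into a small deficit.  The part of F_i outside the star has relative
measure O(eps) at p0, hence O(eps)^s <= O(p eps) at p, and the lower bound on
the product then controls the part of the star missed by F_i.
*)
Require Import Defs.
From mathcomp Require Import all_boot all_order all_algebra.
From mathcomp Require Import reals.
From mathcomp Require Import ring lra.
From mathcomp Require Import interval_inference exp convex hoelder.
Import Order.TTheory GRing.Theory Num.Theory.
Local Open Scope ring_scope.
Set Implicit Arguments.
Unset Strict Implicit.

(** * Product measures on bit lists *)
Fixpoint insert_at (T : Type) (j : nat) (b : T) (s : seq T) : seq T :=
  if j is k.+1 then if s is a :: t then a :: insert_at k b t else [:: b]
  else b :: s.

Lemma size_insert_at (T : Type) j (b : T) s : size (insert_at j b s) = (size s).+1.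
Proof. by elim: j s => [|j IH] [|a s] //=; rewrite IH. Qed.

Lemma map_insert_at (T U : Type) (f : T -> U) j b s :
  map f (insert_at j b s) = insert_at j (f b) (map f s).
Proof. by elim: j s => [|j IH] [|a s] //=; rewrite IH. Qed.

Lemma nth_insert_at (T : Type) (x0 : T) j b s :
  (j <= size s)%N -> nth x0 (insert_at j b s) j = b.
Proof. by elim: j s => [|j IH] [|a s] //= /IH. Qed.

(** Recursion on the length makes revealing the first point a computation. *)
Fixpoint prob (R : realType) (p : R) (n : nat) (P : pred bitseq) : R :=
  if n is m.+1 then
    p * prob p m (fun s => P (true :: s)) + (1 - p) * prob p m (fun s => P (false :: s))
  else (P [::])%:R.

Section Prob.
Variables (R : realType) (p : R).
Hypotheses (p_ge0 : 0 <= p) (p_le1 : p <= 1).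
Implicit Types P Q : pred bitseq.

Lemma prob_le n P Q : (forall s, size s = n -> P s -> Q s) -> prob p n P <= prob p n Q.
Proof.
elim: n P Q => [|n IH] P Q PQ /=.
  have := PQ [::] erefl; case: (P _) => [->//|_]; exact: ler0n.
by apply: lerD; apply: ler_wpM2l; rewrite ?subr_ge0 //; apply: IH => s ss; apply: PQ; rewrite /= ss.
Qed.

Lemma eq_prob n P Q : (forall s, size s = n -> P s = Q s) -> prob p n P = prob p n Q.
Proof. by move=> PQ; apply: le_anti; rewrite !prob_le // => s /PQ->. Qed.

Lemma prob0 n : prob p n pred0 = 0.
Proof. by elim: n => //= n ->; rewrite !mulr0 addr0. Qed.

Lemma probC n P : prob p n (fun s => ~~ P s) = 1 - prob p n P.
Proof.
elim: n P => [|n IH] P /=; last by rewrite !IH; ring.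
by case: (P _) => /=; rewrite ?subrr ?subr0.
Qed.

Lemma prob_ge0 n P : 0 <= prob p n P.
Proof. by rewrite -(prob0 n); apply: prob_le. Qed.

Lemma prob_le1 n P : prob p n P <= 1.
Proof. by rewrite -subr_ge0 -probC prob_ge0. Qed.

Lemma prob_insert_at n j P : (j <= n)%N ->
  prob p n.+1 P = p * prob p n (fun s => P (insert_at j true s))
                + (1 - p) * prob p n (fun s => P (insert_at j false s)).
Proof.
elim: n j P => [|n IH] [|j] P //= jn.
by have /= := IH j (fun s => P (true :: s)) jn; have /= := IH j (fun s => P (false :: s)) jn
  => -> ->; ring.
Qed.

End Prob.

(** [all2] fails on lists of different lengths, so only lists of equal length are compared. *)
Definition up (P : pred bitseq) := forall s t, all2 implb s t -> P s -> P t.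

Lemma all2_implb_refl s : all2 implb s s.
Proof. by elim: s => //= -[]. Qed.

Lemma up_insert_at P j b : up P -> up (fun s => P (insert_at j b s)).
Proof.
move=> uP s t st; apply: uP; elim: j s t st => [|j IH] [|a s] [|c t] //=.
- by case: b.
- by rewrite implybb => /andP[-> ->].
- by rewrite implybb.
- by case/andP=> -> /IH.
Qed.

Lemma prob_up_le (R : realType) (p : R) n P : 0 <= p -> p <= 1 -> up P ->
  prob p n (fun s => P (false :: s)) <= prob p n (fun s => P (true :: s)).
Proof.
by move=> p0 p1 uP; apply: prob_le => // s _; apply: uP; rewrite /= all2_implb_refl.
Qed.

(** * The colour coupling *)

(* Law of the pair (A_c, A_k), c <> k, when each coordinate gets a uniform
   colour in 'I_r, A_i is the set of coordinates not coloured i, and q = 1/r. *)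
Fixpoint joint (R : realType) (q : R) (n : nat) (P Q : pred bitseq) : R :=
  if n is m.+1 then
    q * joint q m (fun s => P (false :: s)) (fun s => Q (true :: s))
    + q * joint q m (fun s => P (true :: s)) (fun s => Q (false :: s))
    + (1 - 2 * q) * joint q m (fun s => P (true :: s)) (fun s => Q (true :: s))
  else (P [::] && Q [::])%:R.

Section Joint.
Variables (R : realType) (q : R).
Hypotheses (q_gt0 : 0 < q) (q_le : q <= 1 / 3).
Implicit Types P Q : pred bitseq.

Lemma joint_le_prob n P Q : joint q n P Q <= prob (1 - q) n Q.
Proof.
have q0 := q_gt0; have q3 := q_le.
elim: n P Q => [|n IH] P Q /=.
  by case: (P _) => //=; exact: ler0n.
have h1 := IH (fun s => P (false :: s)) (fun s => Q (true :: s)).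
have h2 := IH (fun s => P (true :: s)) (fun s => Q (false :: s)).
have h3 := IH (fun s => P (true :: s)) (fun s => Q (true :: s)).
have := ler_wpM2l (ltW q_gt0) h1; have := ler_wpM2l (ltW q_gt0) h2.
have q2 : 0 <= 1 - 2 * q by lra.
have := ler_wpM2l q2 h3; lra.
Qed.

(* The maximal correlation q / (1 - q) of one coordinate tensorizes by the law
   of total variance. *)
Lemma joint_le n P Q :
  joint q n P Q <= prob (1 - q) n P * prob (1 - q) n Q
    + q / (1 - q) / 2 * (prob (1 - q) n P * (1 - prob (1 - q) n P)
                         + prob (1 - q) n Q * (1 - prob (1 - q) n Q)).
Proof.
have q0 := q_gt0; have q3 := q_le; set h := q / (1 - q) / 2.
elim: n P Q => [|n IH] P Q /=.
  by case: (P _) => //=; case: (Q _) => /=; lra.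
have := IH (fun s => P (true :: s)) (fun s => Q (true :: s)).
have := IH (fun s => P (true :: s)) (fun s => Q (false :: s)).
have := IH (fun s => P (false :: s)) (fun s => Q (true :: s)).
set x0 := prob _ n (fun s => P (false :: s)); set x1 := prob _ n (fun s => P (true :: s)).
set y0 := prob _ n (fun s => Q (false :: s)); set y1 := prob _ n (fun s => Q (true :: s)).
move=> h1 h2 h3.
have {}h1 := ler_wpM2l (ltW q_gt0) h1; have {}h2 := ler_wpM2l (ltW q_gt0) h2.
have q2 : 0 <= 1 - 2 * q by lra.
have {}h3 := ler_wpM2l q2 h3.
apply: le_trans (lerD (lerD h1 h2) h3) _; rewrite -subr_ge0.
have -> : h = q * (2 * (1 - q))^-1 by rewrite /h; field; apply/negP => /eqP; lra.
set X := (X in 0 <= X).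
(* The between-values part of the variances exceeds that of the product by a perfect square. *)
have -> : X = q ^+ 2 / 2 * ((x1 - x0) + (y1 - y0)) ^+ 2.
  by rewrite /X; field; apply/negP => /eqP; lra.
by rewrite mulr_ge0 ?sqr_ge0// divr_ge0 ?sqr_ge0.
Qed.

End Joint.

(* x is a colouring of the points and [seq d != i | d <- x] the set A_i: this is
   the only instance of cross-intersection that the argument needs. *)
Definition cross r n (F : 'I_r -> pred bitseq) :=
  forall x : seq 'I_r, size x = n -> exists i, ~~ F i [seq d != i | d <- x].

Definition colsec r j d (F : 'I_r -> pred bitseq) : 'I_r -> pred bitseq :=
  fun i s => F i (insert_at j (d != i) s).

Lemma cross_colsec r n j d (F : 'I_r -> pred bitseq) : cross n.+1 F -> cross n (colsec j d F).
Proof.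
move=> cF x sx; have [|i Fi] := cF (insert_at j d x); first by rewrite size_insert_at sx.
by exists i; rewrite /colsec -(map_insert_at (fun d => d != i)).
Qed.

(** * Averaging over the colour of one point *)

Section Colors.
Variables (R : realType) (r : nat).
Hypothesis hr : (3 <= r)%N.
Implicit Types (F : 'I_r -> pred bitseq) (i k c d : 'I_r).

Let q : R := r%:R^-1.

Lemma third_color c k : exists2 d, d != c & d != k.
Proof.
have : (0 < #|~: [set c; k]|)%N.
  by rewrite cardsCs setCK card_ord subn_gt0 (leq_ltn_trans _ hr) // cards2; case: (_ == _).
by case/card_gt0P=> d; rewrite !inE negb_or => /andP[dc dk]; exists d.
Qed.

Lemma rq : r%:R * q = 1.
Proof. by rewrite mulfV // pnatr_eq0; case: r hr. Qed.

Lemma q_gt0 : 0 < q.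
Proof. by rewrite invr_gt0 ltr0n; case: r hr. Qed.

Lemma q_le : q <= 1 / 3.
Proof. by rewrite div1r lef_pV2 ?posrE ?ltr0n ?ler_nat //; case: r hr. Qed.

Lemma sum_but1 (T : nmodType) c (f : 'I_r -> T) :
  \sum_i f i = f c + \sum_(i | i != c) f i.
Proof. exact: bigD1. Qed.

Lemma sum_but2 (T : nmodType) c k (f : 'I_r -> T) : c != k ->
  \sum_i f i = f c + f k + \sum_(i | (i != c) && (i != k)) f i.
Proof. by move=> ck; rewrite (bigD1 c) // (bigD1 k) 1?eq_sym //= addrA. Qed.

Lemma sum_const1 c (x : R) : \sum_(i | i != c) x = (r%:R - 1) * x.
Proof.
have := sum_but1 c (fun=> x); rewrite sumr_const card_ord => h.
by rewrite mulrBl mulr_natl h mul1r addrAC subrr add0r.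
Qed.

Lemma sum_const2 c k (x : R) : c != k -> \sum_(i | (i != c) && (i != k)) x = (r%:R - 2) * x.
Proof.
move=> ck; have := sum_but2 (fun=> x) ck; rewrite sumr_const card_ord => h.
by rewrite mulrBl (mulr_natl x r) h; ring.
Qed.

Lemma sum_color c (f : bool -> R) :
  q * \sum_d f (d != c) = (1 - q) * f true + q * f false.
Proof.
rewrite (sum_but1 c) eqxx /= (eq_bigr (fun=> f true)) => [|d ->//].
by rewrite sum_const1 mulrDr mulrA mulrBr mulr1 [q * r%:R]mulrC rq addrC.
Qed.

(** A colour deletes the point from at most one of [A_c] and [A_k], whence the three terms of
    [joint]. *)
Lemma sum_color2 c k (f : bool -> bool -> R) : c != k ->
  q * \sum_d f (d != c) (d != k) =
  q * f false true + q * f true false + (1 - 2 * q) * f true true.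
Proof.
move=> ck; rewrite (sum_but2 _ ck) !eqxx ck eq_sym ck /=.
rewrite (eq_bigr (fun=> f true true)) => [|d /andP[-> ->]//].
by rewrite sum_const2 // mulrDr mulrA mulrBr [q * r%:R]mulrC rq; ring.
Qed.

Lemma joint_color n F c k : c != k ->
  joint q n.+1 (F c) (fun s => ~~ F k s) =
  q * \sum_d joint q n (colsec 0 d F c) (fun s => ~~ colsec 0 d F k s).
Proof.
by move=> ck; rewrite (sum_color2 (fun a b =>
  joint q n (fun s => F c (a :: s)) (fun s => ~~ F k (b :: s))) ck).
Qed.

Lemma prob_color n j F i : (j <= n)%N ->
  prob (1 - q) n.+1 (F i) = q * \sum_d prob (1 - q) n (colsec j d F i).
Proof.
move=> jn; rewrite (prob_insert_at _ _ jn) opprD opprK addrA subrr add0r.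
by rewrite (sum_color i (fun a => prob (1 - q) n (fun s => F i (insert_at j a s)))).
Qed.

Let p_ge0 : 0 <= 1 - q. Proof. by have := q_le; lra. Qed.
Let p_le1 : 1 - q <= 1. Proof. by have := q_gt0; lra. Qed.

(** Union bound: when [A_c] lies in [F c], cross-intersection provides some [k != c] with [A_k]
    outside [F k]. *)
Lemma prob_le_joint n F c : cross n F ->
  prob (1 - q) n (F c) <= \sum_(k | k != c) joint q n (F c) (fun s => ~~ F k s).
Proof.
elim: n F => [|n IH] F cF.
  have [k Fk] := cF [::] erefl; rewrite /=.
  have j0 i : 0 <= (F c [::] && ~~ F i [::])%:R :> R by exact: ler0n.
  case Fc: (F c [::]) => /=; last by rewrite big1.
  rewrite (bigD1 k) /=; last by apply: contraNneq Fk => ->.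
  by rewrite (Fk : ~~ F k [::]) lerDl sumr_ge0 // => i _; exact: ler0n.
rewrite (prob_color F c (leq0n n)) [leRHS](eq_bigr (fun k => q * \sum_d
  joint q n (colsec 0 d F c) (fun s => ~~ colsec 0 d F k s))) => [|k kc]; last first.
  by apply: joint_color; rewrite eq_sym.
rewrite -mulr_sumr exchange_big /=; apply: ler_wpM2l; first exact: ltW q_gt0.
by apply: ler_sum => d _; apply: IH; apply: cross_colsec.
Qed.

(** * The deficit and the structure of tuples for which it is small *)

Definition deficit n F : R := (r%:R - 1) - \sum_i prob (1 - q) n (F i).

Lemma deficit_color n j F : (j <= n)%N ->
  deficit n.+1 F = q * \sum_d deficit n (colsec j d F).
Proof.
move=> jn; rewrite /deficit sumrB exchange_big /= sumr_const card_ord.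
rewrite mulrBr mulr_sumr -(mulr_natl (r%:R - 1) r) mulrA [q * r%:R]mulrC rq mul1r; congr (_ - _).
by apply: eq_bigr => i _; exact: prob_color.
Qed.

(** The deficit is the expected number of [i] with [A_i] outside [F i], minus one, and every
    colouring has such an [i]. *)
Lemma deficit_ge0 n F : cross n F -> 0 <= deficit n F.
Proof.
elim: n F => [|n IH] F cF; last first.
  rewrite (deficit_color _ (leq0n n)) mulr_ge0 ?(ltW q_gt0) // sumr_ge0 // => d _.
  by apply: IH; apply: cross_colsec.
have [k /= Fk] := cF [::] erefl.
rewrite /deficit (sum_but1 k) /= (negbTE Fk) add0r subr_ge0 -[leRHS]mulr1.
by rewrite -(sum_const1 k) ler_sum // => i _; by rewrite lern1 leq_b1.
Qed.

Lemma deficit_colsec n j d F : (j <= n)%N -> cross n.+1 F ->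
  deficit n (colsec j d F) <= r%:R * deficit n.+1 F.
Proof.
move=> jn cF; rewrite (deficit_color _ jn) mulrA rq mul1r (sum_but1 d) lerDl.
by apply: sumr_ge0 => i _; apply: deficit_ge0; apply: cross_colsec.
Qed.

Lemma exists_deficit_colsec n F : exists d, deficit n (colsec 0 d F) <= deficit n.+1 F.
Proof.
apply/existsP; apply: contraT; rewrite negb_exists => /forallP h.
have: deficit n.+1 F < q * \sum_(d : 'I_r) deficit n (colsec 0 d F).
  rewrite -[ltLHS]mul1r -rq [_ * q]mulrC -mulrA ltr_pM2l ?q_gt0 //.
  rewrite mulr_natl -[r in _ *+ r](card_ord r) -sumr_const.
  apply: ltr_sum => [|d _]; last by rewrite ltNge h.
  by apply/hasP; exists (Ordinal (ltn_trans (ltn0Sn 1) hr)) => //; rewrite mem_index_enum.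
by rewrite (deficit_color _ (leq0n n)) ltxx.
Qed.

(** The model has [F c] empty and all other families full; its deficit is 0. *)
Definition trivial_within eta n c F :=
  forall i, if i == c then prob (1 - q) n (F i) <= eta else 1 - eta <= prob (1 - q) n (F i).

(** Let [b] be the measure of [F c] and [A] the total measure missed by the other families, so that
    the deficit is [A - b]. The union bound and the correlation bound give [b <= 2 / 3 * A], hence
    [A <= 3 * D]. *)
Lemma trivial_improve n c F : cross n F -> trivial_within (q / 8) n c F ->
  trivial_within (3 * deficit n F) n c F.
Proof.
move=> cF tF; set D := deficit n F.
set al : 'I_r -> R := fun k => 1 - prob (1 - q) n (F k).
set b := prob (1 - q) n (F c); set A := \sum_(k | k != c) al k.
have al_ge0 k : 0 <= al k by rewrite subr_ge0 prob_le1.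
have q0 := q_gt0; have q3 := q_le; have rq1 := rq.
have b_ge0 : 0 <= b by exact: prob_ge0.
have A_le : A <= 1 / 8.
  have : A <= \sum_(k | k != c) q / 8.
    by apply: ler_sum => k kc; have := tF k; rewrite (negbTE kc) /al; lra.
  rewrite sum_const1; nra.
have DE : D = A - b.
  rewrite /D /deficit (sum_but1 c) -/b /A sumrB sum_const1; ring.
have bE : b <= b * A + (b + q / (1 - q) * A) / 2.
  apply: le_trans (prob_le_joint c cF) _.
  set h := q / (1 - q) / 2.
  have h0 : 0 <= h by rewrite !divr_ge0 ?ler0n //; lra.
  (* As [r - 1 = (1 - q) / q], the [r - 1] correlation terms in [b] add up to only [b / 2]. *)
  have hE : (r%:R - 1) * h = 1 / 2.
    by rewrite /h !mulrA mulrBl rq1 mul1r mulfV //; apply/eqP; lra.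
  apply: (@le_trans _ _ (\sum_(k | k != c) (b * al k + h * (b + al k)))).
    apply: ler_sum => k kc; apply: le_trans (joint_le q_gt0 q_le _ _ _) _.
    rewrite probC -/b -/(al k) -/h lerD2l; apply: ler_wpM2l => //.
    have := al_ge0 k; nra.
  rewrite big_split /= -!mulr_sumr [in X in _ + X]big_split /= sum_const1 -/A.
  have hb : h * ((r%:R - 1) * b) = b / 2 by rewrite mulrCA mulrA hE; lra.
  have hA : h * A = q / (1 - q) * A / 2 by rewrite /h; ring.
  rewrite [X in _ + X]mulrDr hb hA; lra.
have q2 : q / (1 - q) <= 1 / 2.
  by rewrite ler_pdivrMr; lra.
have A0 : 0 <= A by exact: sumr_ge0.
have bA : b <= 2 / 3 * A by nra.
move=> i; case: ifP => [/eqP->|/negbT ic]; first by rewrite -/b DE; lra.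
have : al i <= A by rewrite /A (bigD1 i) //= lerDl sumr_ge0.
by rewrite /al DE; lra.
Qed.

Lemma prob_pair_ge n F c k : c != k ->
  1 - deficit n F <= prob (1 - q) n (F c) + prob (1 - q) n (F k).
Proof.
move=> ck; rewrite /deficit (sum_but2 _ ck).
have : \sum_(i | (i != c) && (i != k)) prob (1 - q) n (F i) <= r%:R - 2.
  rewrite -[leRHS]mulr1 -(sum_const2 _ ck) ler_sum // => i _; exact: prob_le1.
lra.
Qed.

Lemma prob_pair_le n F c k th : cross n F -> c != k ->
  (forall i, i != c -> i != k -> 1 - th <= prob (1 - q) n (F i)) ->
  prob (1 - q) n (F c) + prob (1 - q) n (F k) <= 1 + (r%:R - 2) * th.
Proof.
move=> cF ck Fi; have := deficit_ge0 cF; rewrite /deficit (sum_but2 _ ck).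
have : (r%:R - 2) * (1 - th) <= \sum_(i | (i != c) && (i != k)) prob (1 - q) n (F i).
  by rewrite -(sum_const2 _ ck) ler_sum // => i /andP[? ?]; exact: Fi.
lra.
Qed.

(** The measures [x] of [F c] and [y] of [F k] add up to nearly 1, and by the union bound [x] is at
    most their joint term [J] plus a small error. The correlation bound makes [J] at most
    [x ^+ 2 + x * (1 - x) / 2] up to O(u), so [x * (1 - x)] is small. *)
Lemma prob_dichotomy n F c k th u : cross n F -> c != k -> deficit n F <= th ->
  0 <= th -> r%:R * th <= u ->
  (forall i, i != c -> i != k -> 1 - th <= prob (1 - q) n (F i)) ->
  prob (1 - q) n (F c) <= 10 * u \/ 1 - 10 * u <= prob (1 - q) n (F c).
Proof.
move=> cF ck dF th0 ru Fi; have := prob_le_joint c cF.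
have := prob_pair_le cF ck Fi; have := prob_pair_ge n F ck.
rewrite (bigD1 k) 1?eq_sym //=.
have := joint_le q_gt0 q_le n (F c) (fun s => ~~ F k s); rewrite probC.
have : \sum_(i | (i != c) && (i != k)) joint q n (F c) (fun s => ~~ F i s) <= (r%:R - 2) * th.
  rewrite -(sum_const2 _ ck) ler_sum // => i /andP[ic ik].
  apply: le_trans (joint_le_prob q_gt0 q_le _ _ _) _; rewrite probC.
  by have := Fi i ic ik; lra.
set x := prob _ _ (F c); set y := prob _ _ (F k); set J := joint _ _ _ _; set S := \sum_(i | _) _.
have x0 : 0 <= x by exact: prob_ge0.
have x1 : x <= 1 by exact: prob_le1.
have y0 : 0 <= y by exact: prob_ge0.
have y1 : y <= 1 by exact: prob_le1.
have := q_gt0; have := q_le; set h := q / (1 - q) / 2 => q3 q0 hS hJ hxy hyx hx.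
have th3 : 3 * th <= u by apply: le_trans ru; rewrite ler_wpM2r // ler_nat.
have h0 : 0 <= h by rewrite !divr_ge0 ?ler0n //; lra.
have h1 : h <= 1 / 4
  by have : q / (1 - q) <= 1 / 2 by [rewrite ler_pdivrMr; lra]; rewrite /h; lra.
pose e := 1 - y - x.
have e1 : e <= u by rewrite /e; lra.
have e2 : - u <= e by rewrite /e; lra.
have yE : 1 - y = x + e by rewrite /e; ring.
rewrite yE in hJ.
have xe : x * e <= u by nra.
have ve : (x + e) * (1 - (x + e)) <= x * (1 - x) + u.
  have ey : 0 <= x + e <= 1 by rewrite -yE; lra.
  have : e * (1 - x - (x + e)) <= u by nra.
  lra.
have v0 : 0 <= x * (1 - x) by rewrite mulr_ge0 // subr_ge0.
have : h * (x * (1 - x) + (x + e) * (1 - (x + e))) <= 1 / 4 * (2 * (x * (1 - x)) + u).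
  apply: (@le_trans _ _ (h * (2 * (x * (1 - x)) + u))).
    by apply: ler_wpM2l => //; lra.
  by apply: ler_wpM2r => //; lra.
move=> hV; have key : x * (1 - x) <= 5 * u by lra.
have [xh|xh] := leP x (1 / 2); [left|right]; nra.
Qed.

(* The closeness q / 8 = 11 u is what revealing one point may cost, while the
   restriction of smallest deficit is close up to th = u / r.  The second
   alternative says that F i is close to the star of j for every i. *)
Lemma trivial_or_star n F : (forall i, up (F i)) -> cross n F -> deficit n F <= q ^+ 3 / 264 ->
  (exists c, trivial_within (q / 8) n c F) \/
  (exists2 j, (j < n)%N & forall d, trivial_within (q / 8) n.-1 d (colsec j d F)).
Proof.
have rq1 := rq; have q0 := q_gt0; have q3 := q_le.
(* Since 264 = 3 * 88, [r * e0 = th / 3]: a restriction of deficit at most [r * e0] that is within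
   [q / 8] is within [th] by [trivial_improve]. *)
set e0 := q ^+ 3 / 264; set u := q / 88; set th := q * u.
have u0 : 0 < u by rewrite divr_gt0 ?ltr0n.
have th0 : 0 < th by rewrite mulr_gt0.
have thu : th <= u / 3 by rewrite /th; nra.
have rth : r%:R * th = u by rewrite /th mulrA rq1 mul1r.
have eth : r%:R * e0 = th / 3.
  by rewrite /e0 exprS !mulrA rq1 mul1r /th /u; field.
have e_th : 3 * e0 <= th.
  have : 3 * e0 <= r%:R * e0.
    by rewrite ler_wpM2r ?ler_nat // divr_ge0 ?exprn_ge0 ?ler0n ?(ltW q0).
  by rewrite eth; lra.
have q8 : q / 8 = 11 * u by rewrite /u; field.
elim: n F => [|n IH] F upF cF dF.
  left; have [k Fk] := cF [::] erefl; exists k => i; case: ifP => [/eqP->|/negbT ik] /=.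
    by rewrite (negbTE Fk) divr_ge0 ?ler0n ?(ltW q0).
  have := prob_pair_ge 0 F ik; rewrite /= (negbTE Fk) addr0.
  case: (F i [::]) => /= h; first by rewrite lerBlDl lerDr divr_ge0 ?ler0n ?(ltW q0).
  by rewrite -[false%:R]/(0 : R) in h *; lra.
(* This colour does not increase the deficit, so the induction hypothesis applies; any other colour
   costs at most a factor [r]. *)
have [c0 dc0] := exists_deficit_colsec n F.
have dT d : deficit n (colsec 0 d F) <= th / 3.
  rewrite -eth; apply: le_trans (deficit_colsec d (leq0n n) cF) _.
  by rewrite ler_pM2l // ltr0n; case: r hr.
have cT d : cross n (colsec 0 d F) by exact: cross_colsec.
have upT i : up (colsec 0 c0 F i) by exact: up_insert_at.
have dF0 : deficit n (colsec 0 c0 F) <= e0 by exact: le_trans dc0 dF.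
pose m a i := prob (1 - q) n (fun s => F i (a :: s)).
have mono i : m false i <= m true i by apply: prob_up_le.
have mE i : prob (1 - q) n.+1 (F i) = (1 - q) * m true i + q * m false i.
  by rewrite /= -/(m true i) -/(m false i) opprD opprK addrA subrr add0r.
have cvx_le x a b : a <= x -> b <= x -> (1 - q) * a + q * b <= x by nra.
have cvx_ge x a b : x <= a -> x <= b -> x <= (1 - q) * a + q * b by nra.
have avg_le i x : m true i <= x -> m false i <= x -> prob (1 - q) n.+1 (F i) <= x.
  by rewrite mE; exact: cvx_le.
have avg_ge i x : x <= m true i -> x <= m false i -> x <= prob (1 - q) n.+1 (F i).
  by rewrite mE; exact: cvx_ge.
have mT d i : prob (1 - q) n (colsec 0 d F i) = m (d != i) i by [].
have [[d tF]|[j jn sF]] := IH _ upT (cT c0) dF0.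
  have {}tF i : if i == d then m (c0 != i) i <= th else 1 - th <= m (c0 != i) i.
    have := trivial_improve (cT c0) tF i; rewrite mT.
    case: ifP => _ h; [apply: (le_trans h)|apply: le_trans _ h]; lra.
  (* If [d = c0], the unknowns are [m true c0] and the [m false i]. Giving the first point colour
     [i] pairs them, all other families being nearly full, and [prob_dichotomy] applies. A small
     [m true c0] makes the tuple trivial, a large one makes the first point the centre of a star. *)
  have [dc|dc] := eqVneq d c0.
    subst d; have f0 : m false c0 <= th by have := tF c0; rewrite !eqxx.
    have t1 k : k != c0 -> 1 - th <= m true k.
      by move=> kc; have := tF k; rewrite (negbTE kc) eq_sym kc.
    have lo i : i != c0 -> 1 - th / 3 <= m true c0 + m false i.
      move=> ic; have := prob_pair_ge n (colsec 0 i F) ic; rewrite !mT ic eqxx /=.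
      have := dT i; lra.
    have others i k : k != c0 -> k != i -> 1 - th <= prob (1 - q) n (colsec 0 i F k).
      by move=> kc ki; rewrite mT eq_sym ki; exact: t1.
    have hi i : i != c0 -> m true c0 + m false i <= 1 + (r%:R - 2) * th.
      rewrite eq_sym => ci.
      have := prob_pair_le (cT i) ci (others i); rewrite !mT eqxx eq_sym ci; lra.
    have [i ic _] := third_color c0 c0.
    have ci : c0 != i by rewrite eq_sym.
    have := prob_dichotomy (u := u) (cT i) ci _ (ltW th0) _ (others i).
    rewrite mT ic rth => /(_ _ (lexx _)) []; first by have := dT i; lra.
      move=> x0; left; exists c0 => k; case: ifP => [/eqP->|/negbT kc].
        by rewrite q8; apply: avg_le; lra.
      by have := lo k kc; have := t1 k kc; rewrite q8 => ? ?; apply: avg_ge; lra.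
    move=> x1; right; exists 0%N => // d k; rewrite mT q8.
    case: ifP => [/eqP->|/negbT kd].
      rewrite eqxx; have [->|/hi] := eqVneq d c0; first lra.
      by rewrite mulrBl rth; lra.
    rewrite eq_sym kd; have [->|/t1] := eqVneq k c0; lra.
  (* Monotonicity bounds the unknown halves for [d] and [c0]; for any other [i], colour [i] pairs
     [m false i] with the small [m true d]. *)
  left; exists d.
  have td : m true d <= th by have := tF d; rewrite eqxx eq_sym dc.
  have fc : 1 - th <= m false c0 by have := tF c0; rewrite eq_sym (negbTE dc) eqxx.
  move=> i; rewrite q8; have := mono i; case: ifP => [/eqP->|/negbT id] mi.
    by apply: avg_le; lra.
  have [ic|ic] := eqVneq i c0; first by subst i; apply: avg_ge; lra.
  have := tF i; rewrite (negbTE id) eq_sym ic => ti.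
  have := prob_pair_ge n (colsec 0 i F) id; rewrite !mT eqxx id => pi.
  by have := dT i => di; apply: avg_ge; lra.
case: n => [//|n] in {IH} F upF cF dF c0 dc0 dT cT upT dF0 m mono mE avg_le avg_ge mT jn sF *.
right; exists j.+1 => //.
(* The bits at the first point and at [j.+1] are [a] and [b]. The induction hypothesis covers
   [a = (c0 != i)]; monotonicity in [a] leaves only [w false true i] for [i != c0] and
   [w true false c0]. *)
pose w a b i := prob (1 - q) n (fun s => F i (a :: insert_at j b s)).
have wT c d i : prob (1 - q) n (colsec j d (colsec 0 c F) i) = w (c != i) (d != i) i by [].
have wS d i : prob (1 - q) n.+1 (colsec j.+1 d F i) =
    (1 - q) * w true (d != i) i + q * w false (d != i) i.
  by rewrite /= opprD opprK addrA subrr add0r.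
have monow b i : w false b i <= w true b i.
  by apply: prob_le => // s _; apply: upF; rewrite /= all2_implb_refl.
have dTT c d : deficit n (colsec j d (colsec 0 c F)) <= r%:R * deficit n.+1 (colsec 0 c F).
  exact: deficit_colsec.
have cTT c d : cross n (colsec j d (colsec 0 c F)) by exact: cross_colsec.
have {}sF d i : if i == d then w (c0 != i) (d != i) i <= th else 1 - th <= w (c0 != i) (d != i) i.
  have := trivial_improve (cTT c0 d) (sF d) i; rewrite wT.
  have : 3 * deficit n (colsec j d (colsec 0 c0 F)) <= th.
    have : r%:R * deficit n.+1 (colsec 0 c0 F) <= r%:R * e0 by rewrite ler_wpM2l.
    have := dTT c0 d; lra.
  case: ifP => _ ? h; [apply: (le_trans h)|apply: le_trans _ h]; lra.
have w0 i : w (c0 != i) false i <= th by have := sF i i; rewrite !eqxx.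
have w1 i : 1 - th <= w (c0 != i) true i.
  by have [d di _] := third_color i i; have := sF d i; rewrite eq_sym (negbTE di).
(* Colour the first point [i] and point [j.+1] a third colour [k]: family [k] then has the small
   measure [w true false k], so family [i] has a large one. *)
have wft i : i != c0 -> 1 - u / 3 - th <= w false true i.
  move=> ic; have [k kc ki] := third_color c0 i.
  have ik : i != k by rewrite eq_sym.
  have := prob_pair_ge n (colsec j k (colsec 0 i F)) ik; rewrite !wT !eqxx ik ki /=.
  have := w0 k; rewrite eq_sym kc.
  have : r%:R * deficit n.+1 (colsec 0 i F) <= u / 3.
    by rewrite -rth -mulrA ler_wpM2l.
  have := dTT i k; lra.
(* With colours [i] and [c0], family [c0] is paired with [w false true i], now known to be large. *)
have wtf : w true false c0 <= 11 * u.
  have [i ic _] := third_color c0 c0.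
  have ci : c0 != i by rewrite eq_sym.
  have := prob_pair_le (th := th) (cTT i c0) ci; rewrite !wT !eqxx ic ci => h.
  have {h} : w true false c0 + w false true i <= 1 + (r%:R - 2) * th.
    apply: h => k kc ki; rewrite wT eq_sym ki.
    by have := w1 k; rewrite eq_sym kc.
  have := wft i ic; rewrite mulrBl rth; lra.
move=> d i; rewrite wS q8; have := monow false i; have := monow true i.
have [id|id] := eqVneq i d => /= mt mf; have w0i := w0 i; have w1i := w1 i;
  [apply: cvx_le|apply: cvx_ge].
- move: w0i; have [->|ic] := eqVneq i c0 => /=; lra.
- move: w0i; have [ic|ic] := eqVneq i c0 => /=; lra.
- move: w1i; have [ic|ic] := eqVneq i c0 => /=; lra.
- move: w1i; have [ic|/wft] := eqVneq i c0 => /=; lra.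
Qed.

End Colors.

(** * Changing the bias *)

Lemma powR_convex (R : realType) (s t a b : R) : 1 <= s -> 0 <= t -> t <= 1 ->
  0 <= a -> 0 <= b ->
  (t * a + (1 - t) * b) `^ s <= t * a `^ s + (1 - t) * b `^ s.
Proof.
move=> s1 t0 t1 a0 b0.
have := convex_powR s1 (Itv01 t0 t1) (x := a) (y := b).
by rewrite !classical_sets.in_setE /= !in_itv /= !andbT => /(_ a0 b0).
Qed.

(** With [z = p * x + (1 - p) * y], the claim is that the [s]-th powers of [p * x] and [y] sum to at
    most those of [z] and [p * y]. The two pairs have equal sums and the first lies between the
    entries of the second, so convexity applies. *)
Lemma powR_mix (R : realType) (s p x y : R) : 1 <= s -> 0 <= p -> p <= 1 ->
  0 <= y -> y <= x ->
  p `^ s * x `^ s + (1 - p `^ s) * y `^ s <= (p * x + (1 - p) * y) `^ s.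
Proof.
move=> s1 p0 p1 y0 yx; have x0 := le_trans y0 yx.
rewrite mulrBl mul1r -!powRM // addrA; set z := p * x + _.
have pypx : p * y <= p * x by exact: ler_wpM2l.
have pxz : p * x <= z by rewrite lerDl mulr_ge0 // subr_ge0.
have yz : y <= z by rewrite /z; lra.
have pyy : p * y <= y by rewrite -[leRHS]mul1r ler_wpM2r.
have py0 : 0 <= p * y by rewrite mulr_ge0.
have [zE|zN] := eqVneq z (p * y).
  have -> : p * x = p * y by lra.
  have -> : z = y by lra.
  lra.
have dz : 0 < z - p * y by rewrite subr_gt0 lt_neqAle eq_sym zN; lra.
pose t := (z - p * x) / (z - p * y).
have t0 : 0 <= t by rewrite divr_ge0 // ?subr_ge0; lra.
have t1 : t <= 1 by rewrite ler_pdivrMr //; lra.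
have tE : t * (z - p * y) = z - p * x by rewrite divfK // gt_eqF.
have z0 : 0 <= z by lra.
have := powR_convex s1 t0 t1 py0 z0.
have -> : t * (p * y) + (1 - t) * z = p * x by lra.
have := powR_convex s1 t0 t1 z0 py0.
have -> : t * z + (1 - t) * (p * y) = y by rewrite /z in tE *; lra.
lra.
Qed.

(* Equivalently, the exponent log_p mu_p(P) is nonincreasing in p. *)
Lemma prob_powR_le (R : realType) (s p : R) n P : 1 <= s -> 0 <= p -> p <= 1 -> up P ->
  prob (p `^ s) n P <= prob p n P `^ s.
Proof.
move=> s1 p0 p1; have s0 : 0 < s by lra.
have ps1 : p `^ s <= 1.
  by have := ge0_ler_powR (ltW s0) (x := p) (y := 1); rewrite !nnegrE powR1; apply.
have ps0 : 0 <= p `^ s by exact: powR_ge0.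
elim: n P => [|n IH] P upP /=.
  by case: (P _); rewrite ?powR1 // powR0 // gt_eqF.
apply: le_trans (powR_mix s1 p0 p1 (prob_ge0 p0 p1 _ _) (prob_up_le n p0 p1 upP)).
apply: lerD; apply: ler_wpM2l; rewrite ?subr_ge0 //.
  by apply: IH; apply: (up_insert_at (j := 0) (b := true)).
by apply: IH; apply: (up_insert_at (j := 0) (b := false)).
Qed.

(** * Families of sets *)

Definition set_of_bits n (s : bitseq) : {set 'I_n} := [set j : 'I_n | nth false s j].

Lemma prob_tuple (R : realType) (p : R) n P :
  prob p n P = \sum_(t : n.-tuple bool) (P t)%:R * \prod_(b <- t) (if b then p else 1 - p).
Proof.
elim: n P => [|n IH] P /=.
  rewrite (big_pred1 [tuple]) => [|t]; last by apply/esym/eqP; rewrite [t]tuple0.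
  by rewrite big_nil mulr1.
rewrite (reindex (fun u : bool * n.-tuple bool => [tuple of u.1 :: u.2])) /=; last first.
  exists (fun t => (thead t, [tuple of behead t])) => [[b t] _|t _] /=.
    by rewrite theadE; congr pair; apply: val_inj.
  by rewrite -tuple_eta.
rewrite -(pair_bigA _ (fun b (t : n.-tuple bool) => (P (b :: t))%:R *
   \prod_(c <- b :: t) (if c then p else 1 - p))) big_bool /= !IH !mulr_sumr.
by congr (_ + _); apply: eq_bigr => t _; rewrite big_cons mulrCA.
Qed.

Lemma biased_measureE (R : realType) (p : R) n (G : {set {set 'I_n}}) :
  biased_measure p G = prob p n (fun s => set_of_bits n s \in G).
Proof.
rewrite prob_tuple (reindex (fun A : {set 'I_n} => [tuple j \in A | j < n])) /=; last first.
  exists (fun t => set_of_bits n (tval t)) => [A _|t _].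
    by apply/setP=> j; rewrite inE -tnth_nth tnth_mktuple.
  by apply: eq_from_tnth => j; rewrite tnth_mktuple inE -tnth_nth.
rewrite /biased_measure big_mkcond /=; apply: eq_bigr => A _.
have -> : set_of_bits n [tuple j \in A | j < n] = A.
  by apply/setP=> j; rewrite inE -tnth_nth tnth_mktuple.
case: ifP => _; last by rewrite mul0r.
rewrite mul1r big_map big_enum_cond /= (bigID [in A]) /=.
rewrite (eq_bigr (fun=> p)) => [|j jA]; last by rewrite jA.
rewrite prodr_const; congr (_ * _).
rewrite (eq_bigr (fun=> 1 - p)) => [|j jA]; last by rewrite (negbTE jA).
rewrite prodr_const; congr (_ ^+ _).
by have /(congr1 (subn^~ #|A|)) := cardC A; rewrite addKn card_ord => /esym.
Qed.

(** The given families need not be increasing; passing to up-closures preserves cross-intersection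
    and cannot decrease measures. *)
Definition upclosure n (G : {set {set 'I_n}}) : {set {set 'I_n}} :=
  [set A : {set 'I_n} | [exists B in G, B \subset A]].

Lemma sub_upclosure n (G : {set {set 'I_n}}) A : A \in G -> A \in upclosure G.
Proof. by move=> GA; rewrite inE; apply/exists_inP; exists A. Qed.

Lemma up_upclosure n (G : {set {set 'I_n}}) :
  up (fun s => set_of_bits n s \in upclosure G).
Proof.
have nth_impl s t j : all2 implb s t -> nth false s j -> nth false t j.
  elim: s t j => [|a s IH] [|b t] [|j] //= /andP[ab st]; [exact/implyP|exact: IH].
move=> s t st; rewrite !inE => /exists_inP[B GB /subsetP sB]; apply/exists_inP; exists B => //.
by apply/subsetP=> j /sB; rewrite !inE; exact: nth_impl.
Qed.

Lemma cross_upclosure n r (F : 'I_r -> {set {set 'I_n}}) : (0 < r)%N ->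
  cross_intersecting F -> cross n (fun i s => set_of_bits n s \in upclosure (F i)).
Proof.
move=> r0 cF x sx; apply/existsP; apply: contraT; rewrite negb_exists => /forallP h.
have {}h i : exists B, B \in F i /\ B \subset set_of_bits n [seq d != i | d <- x].
  by have := h i; rewrite negbK inE => /exists_inP[B ? ?]; exists B.
have [B hB] := fin_all_exists h.
have /set0Pn[j /bigcapP jB] := cF B (fun i => (hB i).1).
(* The common point [j] of the [B i] has some colour [i], and is therefore missing from [A_i]. *)
pose i := nth (Ordinal r0) x j.
have := subsetP (hB i).2 j (jB i isT); rewrite inE (nth_map (Ordinal r0)) ?sx //.
by rewrite -/i eqxx.
Qed.

(** * Stability of the product for bias [1 - q] *)

Section ProductStability.
Variables (R : realType) (r : nat).
Hypothesis hr : (3 <= r)%N.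
Let q : R := r%:R^-1.

(** In the final bound, 3 comes from [trivial_improve], one [r] from the deficit [r * eps], the
    other from restricting to a colour at [j]. *)
Lemma star_of_product n (F : 'I_r -> pred bitseq) (eps : R) :
  (forall i, up (F i)) -> cross n F ->
  0 < eps -> eps <= q ^+ 4 * (1 - q) ^+ r / 300 ->
  (1 - eps) * (1 - q) ^+ r <= \prod_i prob (1 - q) n (F i) ->
  exists2 j, (j < n)%N & forall i,
    prob (1 - q) n.-1 (fun s => F i (insert_at j false s)) <= 3 * r%:R ^+ 2 * eps.
Proof.
move=> upF cF e0 eE hP.
have rq1 : r%:R * q = 1 := rq R hr; have q0 : 0 < q := q_gt0 R hr.
have q3 : q <= 1 / 3 := q_le R hr.
have r0 : 0 < r%:R :> R by rewrite ltr0n; case: (r) hr.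
have p0 : 0 < 1 - q by lra.
have p1 : 1 - q <= 1 by lra.
have pr1 : (1 - q) ^+ r <= 1 by rewrite exprn_ile1 // ltW.
have pr0 : 0 < (1 - q) ^+ r by rewrite exprn_gt0.
have q41 : q ^+ 3 <= 1 / 27.
  have : q ^+ 3 <= (1 / 3) ^+ 3 by rewrite lerXn2r ?nnegrE // ltW.
  by rewrite !exprS expr0; lra.
have q30 : 0 < q ^+ 3 by rewrite exprn_gt0.
have eq3 : r%:R * eps <= q ^+ 3 * (1 - q) ^+ r / 300.
  have := ler_wpM2l (ltW r0) eE; rewrite exprS !mulrA rq1 mul1r; lra.
have q3p : q ^+ 3 * (1 - q) ^+ r <= q ^+ 3 by rewrite ler_piMr // ltW.
have q3p' : q ^+ 3 * (1 - q) ^+ r <= 1 / 27 * (1 - q) ^+ r by rewrite ler_wpM2r // ltW.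
have er : 3 * eps <= r%:R * eps by rewrite ler_wpM2r ?ler_nat // ltW.
have e1 : eps <= 1 / 2 by lra.
have m0 i : 0 <= prob (1 - q) n (F i) by apply: prob_ge0; lra.
have m1 i : prob (1 - q) n (F i) <= 1 by apply: prob_le1; lra.
set S := \sum_i prob (1 - q) n (F i).
have dS : deficit R n F = r%:R - 1 - S by [].
have S0 : 0 <= S by exact: sumr_ge0.
(* Otherwise AM-GM puts the product below [((1 - q) * (1 - eps)) ^+ r], and
   [(1 - eps) ^+ r <= 1 - eps]. *)
have hS : (1 - q) * (1 - eps) <= S / r%:R.
  rewrite leNgt; apply/negP => hlt.
  have rn0 : r != 0%N by case: (r) hr.
  have : (S / r%:R) ^+ r < ((1 - q) * (1 - eps)) ^+ r.
    rewrite ltr_pXn2r ?nnegrE //; first by case: (r) hr.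
      by rewrite divr_ge0 // ltW.
    by rewrite mulr_ge0 //; lra.
  have [AG _] := leif_AGM (A := predT) (E := fun i => prob (1 - q) n (F i)) (fun i _ => m0 i).
  rewrite card_ord in AG.
  move=> /(le_lt_trans AG) /(le_lt_trans hP).
  rewrite exprMn mulrC ltr_pM2l // ltNge.
  have -> //: (1 - eps) ^+ r <= 1 - eps.
  case: (r) rn0 => // k _; rewrite exprS ler_piMr //; first lra.
  by rewrite exprn_ile1 //; lra.
have dle : deficit R n F <= r%:R * eps.
  rewrite dS; move: hS; rewrite ler_pdivlMr // => hS.
  have E : (1 - q) * (1 - eps) * r%:R = (r%:R - r%:R * q) * (1 - eps) by ring.
  rewrite E rq1 in hS; lra.
have [|[c tF]|[j jn sF]] := trivial_or_star (R := R) hr upF cF; first by rewrite -/q; lra.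
  (* A trivial tuple is impossible: its product is at most the factor at [c], which is at most
     [3 * r * eps]. *)
  have := trivial_improve hr cF tF c; rewrite eqxx -/q => mc.
  have : \prod_i prob (1 - q) n (F i) <= prob (1 - q) n (F c).
    rewrite (bigD1 c) //= ler_piMr // prodr_ile1 // => i _; rewrite m0 m1 //.
  move=> hm; have : (1 - 1/2) * (1 - q) ^+ r <= (1 - eps) * (1 - q) ^+ r.
    by rewrite ler_wpM2r ?(ltW pr0) //; lra.
  have : 0 < r%:R * eps by rewrite mulr_gt0.
  lra.
exists j => // i; case: n cF jn sF dle {hP m0 m1 S dS S0 hS} => [//|n] cF jn sF dle.
have := trivial_improve hr (cross_colsec j i cF) (sF i) i; rewrite eqxx -/q /=.
rewrite /colsec eqxx => /le_trans; apply.
have := deficit_colsec R hr (n := n) (j := j) i jn cF; rewrite -/q => h.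
have : r%:R * deficit R n.+1 F <= r%:R * (r%:R * eps) by rewrite ler_wpM2l // ltW.
by rewrite expr2; lra.
Qed.

End ProductStability.

(** * Conclusion for bias [p] *)

Lemma expr1D_le (R : realType) (x : R) m : 0 <= x -> x <= 1 ->
  (1 + x) ^+ m <= 1 + (2 ^+ m - 1) * x.
Proof.
move=> x0 x1; elim: m => [|m IH]; first by rewrite !expr0 subrr mul0r addr0.
have h1 : 0 <= 1 + x by lra.
have := ler_wpM2l h1 IH; rewrite -exprS => /le_trans; apply.
have : 1 <= 2 ^+ m :> R by rewrite exprn_ege1 // ler1n.
rewrite (exprS 2); set y := 2 ^+ m => y1.
have : 0 <= (y - 1) * (x * (1 - x)) by rewrite !mulr_ge0 ?subr_ge0.
lra.
Qed.

(** Here [a i] and [b i] are the measures of the sections inside and outside the star. With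
    [x = L * eps], each factor is at most [p * (a k + x)]; bounding [a k] by 1 for [k != i] isolates
    [a i]. *)
Lemma product_defect (R : realType) r (p eps L : R) (a b : 'I_r -> R) :
  0 < p -> p <= 1 -> 0 < eps -> 0 <= L -> L * eps <= 1 ->
  (forall i, 0 <= a i <= 1) -> (forall i, 0 <= b i) ->
  (forall i, b i <= p * (L * eps)) ->
  (1 - eps) * p ^+ r <= \prod_i (p * a i + (1 - p) * b i) ->
  forall i, 1 - a i <= (1 + 2 * 2 ^+ r * L) * eps.
Proof.
move=> p0 p1 e0 L0 Le1 ha b0 hb hP i.
set x := L * eps; have x0 : 0 <= x by rewrite mulr_ge0 // ltW.
rewrite -/x in Le1.
have r1 : (r = r.-1.+1)%N by case: (r) i => [[]|].
have fac k : 0 <= p * a k + (1 - p) * b k <= p * (a k + x).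
  have := b0 k; have := hb k; case/andP: (ha k) => h1 h2 h3 h4.
  rewrite -/x in h3; apply/andP; split; first by rewrite addr_ge0 // mulr_ge0 // ?subr_ge0 // ltW.
  rewrite mulrDr lerD2l; nra.
have : \prod_k (p * a k + (1 - p) * b k) <= p ^+ r * ((a i + x) * (1 + x) ^+ r.-1).
  apply: (@le_trans _ _ (\prod_k (p * (a k + x)))); first by apply: ler_prod => k _.
  rewrite big_split /= prodr_const card_ord; apply: ler_wpM2l; first by rewrite exprn_ge0 // ltW.
  case/andP: (ha i) => ai0 _.
  rewrite (bigD1 i) //=; apply: ler_wpM2l; first by rewrite addr_ge0.
  have -> : (1 + x) ^+ r.-1 = \prod_(k | k != i) (1 + x).
    by rewrite prodr_const; have := cardC1 i; rewrite card_ord => ->.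
  apply: ler_prod => k _; case/andP: (ha k) => ak0 ak1.
  by rewrite addr_ge0 //= lerD2r.
move=> /(le_trans hP); rewrite mulrC ler_pM2l ?exprn_gt0 // => key.
(* The chord of [(1 + x) ^+ m] over [0, 1] keeps the error linear in [x]. *)
have := expr1D_le r.-1 x0 Le1; set Y := (1 + x) ^+ _ in key *.
have : 1 <= 2 ^+ r.-1 :> R by rewrite exprn_ege1 // ler1n.
have -> : 2 ^+ r = 2 * 2 ^+ r.-1 :> R by rewrite {1}r1 exprS.
set z := 2 ^+ r.-1 => z1 hY.
case/andP: (ha i) => ai0 ai1.
have axY : (a i + x) * Y <= (a i + x) * (1 + (z - 1) * x) by apply: ler_wpM2l => //; lra.
have e1 : (a i + x) * (1 + (z - 1) * x) <= a i + x + 2 * ((z - 1) * x).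
  have : 0 <= (z - 1) * (x * (2 - (a i + x))) by rewrite !mulr_ge0 ?subr_ge0 //; lra.
  lra.
have : 0 <= z * x by rewrite mulr_ge0 //; lra.
have -> : (1 + 2 * (2 * z) * L) * eps = eps + 4 * (z * x) by rewrite /x; ring.
lra.
Qed.

Theorem theorem1p3 (R : realType) (r : nat) (hr : (3 <= r)%N) :
  exists eps0 C : R, [/\ 0 < eps0, 0 < C &
    forall (p eps : R) (n : nat) (F : 'I_r -> {set {set 'I_n}}),
      0 < p -> p <= (r%:R - 1) / r%:R ->
      0 < eps -> eps <= eps0 ->
      (1 <= n)%N ->
      cross_intersecting F ->
      (1 - eps) * p ^+ r <= \prod_(i < r) biased_measure p (F i) ->
      exists j : 'I_n, forall i : 'I_r,
        biased_measure p (symdiff (F i) (star j)) <= C * p * eps].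
Proof.
set q : R := r%:R^-1.
have rq1 : r%:R * q = 1 := rq R hr; have q0 : 0 < q := q_gt0 R hr.
have q3 : q <= 1 / 3 := q_le R hr.
have r0 : 0 < r%:R :> R by rewrite ltr0n; case: (r) hr.
set p0 := 1 - q; have p00 : 0 < p0 by rewrite /p0; lra.
have p01 : p0 < 1 by rewrite /p0; lra.
set eps0 := q ^+ 4 * p0 ^+ r / 300.
(* [K] is the constant of [star_of_product]. As [K * eps = p0 * (L * eps)], raising to the power [s]
   with [p = p0 ^ s] will produce the factor [p]. *)
pose K : R := 3 * r%:R ^+ 2; pose L := K / p0.
have K0 : 0 < K by rewrite mulr_gt0 ?exprn_gt0.
have L0 : 0 < L by rewrite divr_gt0.
exists eps0, (1 + 2 * 2 ^+ r * L + L); split.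
- by apply: divr_gt0; [apply: mulr_gt0; exact: exprn_gt0 | rewrite ltr0n].
- have : 0 < 2 ^+ r * L by rewrite mulr_gt0 // exprn_gt0.
  by rewrite -mulrA; lra.
move=> p eps n F p_gt0 p_le e0 e_le _ cF hP.
have {}p_le : p <= p0 by move: p_le; rewrite mulrBl mul1r mulfV ?gt_eqF.
have p_le1 : p <= 1 by lra.
pose f i s := set_of_bits n s \in F i; pose u i s := set_of_bits n s \in upclosure (F i).
have upu i : up (u i) by exact: up_upclosure.
have cu : cross n u by apply: cross_upclosure cF; case: (r) hr.
have fu i s : f i s -> u i s by exact: sub_upclosure.
pose s := ln p / ln p0.
have lp0 : ln p0 < 0 by rewrite ln_lt0 // p00.
have s1 : 1 <= s.
  by rewrite /s ler_ndivlMr // mul1r ler_ln ?posrE.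
have pE : p = p0 `^ s.
  by rewrite /powR gt_eqF // /s divfK ?lt_eqF // lnK // posrE.
have s0 : 0 <= s by lra.
have pr_le : p0 ^+ r <= p0.
  have p0_le := ltW p01; have p0_ge := ltW p00.
  by case: (r) hr => // k _; rewrite exprS ler_piMr // exprn_ile1.
have qn_le1 k : q ^+ k <= 1 by apply: exprn_ile1; lra.
have Keps : K * eps <= p0.
  apply: le_trans (ler_wpM2l (ltW K0) e_le) _.
  have -> : K * eps0 = (r%:R * q) ^+ 2 * (q ^+ 2 * p0 ^+ r) / 100 by rewrite /K /eps0; field.
  have : q ^+ 2 * p0 ^+ r <= p0 ^+ r by rewrite ler_piMl // exprn_ge0 // ltW.
  by rewrite rq1 expr1n mul1r; lra.
have Leps : L * eps <= 1 by rewrite /L mulrAC ler_pdivrMr // mul1r.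
have x_gt0 : 0 < L * eps by exact: mulr_gt0.
have x_ge0 := ltW x_gt0.
have e1 : eps <= 1.
  have : q ^+ 4 * p0 ^+ r <= p0 ^+ r by rewrite ler_piMl // exprn_ge0 // ltW.
  move: e_le; rewrite /eps0; lra.
(* Otherwise [s]-th powers give a contradiction: the measure of [F i] at [p] is at most the [s]-th
   power of that of [u i] at [p0], and [(1 - eps) ^ s <= 1 - eps]. *)
have hu : (1 - eps) * p0 ^+ r <= \prod_i prob p0 n (u i).
  rewrite leNgt; apply/negP => hlt.
  have M0 i : 0 <= prob p0 n (u i) by apply: prob_ge0; exact: ltW.
  have : (\prod_i prob p0 n (u i)) `^ s < ((1 - eps) * p0 ^+ r) `^ s.
    apply: gt0_ltr_powR => //; rewrite ?nnegrE; first lra.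
      by apply: prodr_ge0.
    by rewrite mulr_ge0 ?subr_ge0 // exprn_ge0 // ltW.
  rewrite powRM ?subr_ge0 ?exprn_ge0 ?(ltW p00) // ltNge => /negP; apply.
  have -> : (p0 ^+ r) `^ s = p ^+ r.
    by rewrite pE -(powR_mulrn r (ltW p00)) -(powR_mulrn r (powR_ge0 p0 s)) powRAC.
  apply: (@le_trans _ _ ((1 - eps) * p ^+ r)).
    apply: ler_wpM2r; first by rewrite exprn_ge0 // ltW.
    have [->|en] := eqVneq eps 1; first by rewrite subrr powR0 // gt_eqF //; lra.
    by apply: ge1r_powR => //; apply/andP; split; rewrite ?subr_gt0 ?lt_neqAle ?en //; lra.
  apply: (le_trans hP).
  have -> : (\prod_i prob p0 n (u i)) `^ s = \prod_i (prob p0 n (u i) `^ s).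
    apply/esym; pose T (a b : R) := 0 <= b /\ a = b `^ s.
    suff [] : T (\prod_i (prob p0 n (u i) `^ s)) (\prod_i prob p0 n (u i)) by [].
    apply: (big_rec2 T) => [|i a b _ [b0 ->]]; first by rewrite /T powR1.
    by split; rewrite ?mulr_ge0 // powRM.
  apply: ler_prod => i _; rewrite biased_measureE prob_ge0 ?(ltW p_gt0) //=.
  apply: le_trans (prob_le (ltW p_gt0) p_le1 (fun s _ => fu i s)) _.
  by rewrite pE; apply: prob_powR_le => //; exact: ltW.
have [j jn sj] := star_of_product hr upu cu e0 e_le hu.
case: n => [//|n] in F cF hP f u upu cu fu hu jn sj *.
pose a i := prob p n (fun s => f i (insert_at j true s)).
pose b i := prob p n (fun s => f i (insert_at j false s)).
have mE i : biased_measure p (F i) = p * a i + (1 - p) * b i.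
  by rewrite biased_measureE (prob_insert_at _ _ (_ : j <= n)%N).
have b0 i : 0 <= b i by apply: prob_ge0 => //; exact: ltW.
have a01 i : 0 <= a i <= 1.
  by rewrite prob_ge0 ?prob_le1 ?(ltW p_gt0).
have hb i : b i <= p * (L * eps).
  apply: (@le_trans _ _ (prob p n (fun s => u i (insert_at j false s)))).
    by apply: prob_le => [||s' _ /fu] //; exact: ltW.
  have upj := up_insert_at (j := j) (b := false) (upu i).
  rewrite {1}pE; apply: le_trans (prob_powR_le n s1 _ _ upj) _; try exact: ltW.
  apply: (@le_trans _ _ ((p0 * (L * eps)) `^ s)).
    apply: ge0_ler_powR => //; rewrite ?nnegrE.
    - by apply: prob_ge0; exact: ltW.
    - by rewrite mulr_ge0 // ltW.
    - by rewrite mulrA [p0 * L]mulrC divfK ?gt_eqF //; exact: sj.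
  rewrite powRM ?(ltW p00) // -pE ler_wpM2l ?(ltW p_gt0) //.
  by apply: ge1r_powR => //; apply/andP.
exists (Ordinal jn) => i.
have ha := product_defect p_gt0 p_le1 e0 (ltW L0) Leps a01 b0 hb _ i.
(* Inside the star the symmetric difference is the complement of [F i], outside it is [F i]
   itself. *)
have -> : biased_measure p (symdiff (F i) (star (Ordinal jn))) = p * (1 - a i) + (1 - p) * b i.
  rewrite biased_measureE (prob_insert_at _ _ (_ : j <= n)%N) //; congr (_ * _ + _ * _).
    rewrite -probC; apply: eq_prob => //; first exact: ltW.
    by move=> s' ss; rewrite !inE nth_insert_at ?ss //= andbT.
  apply: eq_prob => //; first exact: ltW.
  by move=> s' ss; rewrite !inE nth_insert_at ?ss //= ?andbT ?andbF ?orbF.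
have {}ha : 1 - a i <= (1 + 2 * 2 ^+ r * L) * eps.
  by apply: ha; under eq_bigr => k _ do rewrite -mE.
apply: (@le_trans _ _ (p * ((1 + 2 * 2 ^+ r * L) * eps) + p * (L * eps))).
  apply: lerD; first by rewrite ler_wpM2l // ltW.
  by apply: le_trans (hb i); rewrite ler_piMl //; lra.
by rewrite le_eqVlt; apply/orP; left; apply/eqP; ring.
Qed.
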